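(* For every bounded distributive lattice $D$, the ordered topological space $\mathcal{M}_{\Gamma}(D)$ of all $\mathbf{\Gamma}$-valued measures on $D$ is a Priestley space.
   Context: The Priestley space $\mathbf{\Gamma}$. Its underlying set consists of formal symbols $\{r^{-}\mid r\in(0,1]\}\cup\{q^{\circ}\mid q\in[0,1]\cap\mathbb{Q}\}$, totally ordered by: $r^{-}<s^{-}$ iff $r<s$; $p^{\circ}<q^{\circ}$ iff $p<q$; $r^{-}<q^{\circ}$ iff $r\le q$; $q^{\circ}<r^{-}$ iff $q<r$. Its topology is generated by the sets $\{x\mid p^{\circ}\le x\}$ for $p\in\mathbb{Q}\cap[0,1]$ and $\{x\mid x\le q^{-}\}$ for $q\in\mathbb{Q}\cap(0,1]$. Two partial operations on $\mathbf{\Gamma}$, $x-y$ and $x\sim y$, are defined exactly when $y\le x$. The first is: $r^{\circ}-s^{\circ}=(r-s)^{\circ}$; $r^{-}-s^{\circ}=(r-s)^{-}$; and both $r^{\circ}-s^{-}$ and $r^{-}-s^{-}$ equal $(r-s)^{\circ}$ if $r-s\in\mathbb{Q}$ and $(r-s)^{-}$ otherwise. The second is $x\sim y=\bigvee\{x-q^{\circ}\mid q\in\mathbb{Q}\cap[0,1],\ y<q^{\circ}\le x\}$ (so $x\sim x=0^{\circ}$, the bottom element). Lattices are bounded with bounds $0,1$. A $\mathbf{\Gamma}$-valued measure on a bounded distributive lattice $D$ is a function $\mu\colon D\to\mathbf{\Gamma}$ such that (1) $\mu$ is monotone; (2) $\mu(0)=0^{\circ}$ and $\mu(1)=1^{\circ}$;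 (3) for all $a,b\in D$, $\mu(a)\sim\mu(a\wedge b)\le\mu(a\vee b)-\mu(b)$ and $\mu(a)-\mu(a\wedge b)\ge\mu(a\vee b)\sim\mu(b)$. The set $\mathcal{M}_{\Gamma}(D)$ of all such measures carries the order and topology induced by the product order and product topology of $\mathbf{\Gamma}^{D}$. A Priestley space is a compact space $X$ with a partial order $\le$ closed in $X\times X$ such that whenever $x\not\le y$ there is a clopen up-set $C$ with $x\in C$, $y\notin C$. *)

(* Defs.v *)
From HB Require Import structures.
From mathcomp Require Import all_boot all_order all_algebra.
From mathcomp Require Import all_classical all_reals all_analysis.

Set Implicit Arguments.
Unset Strict Implicit.
Unset Printing Implicit Defensive.

Import Order.TTheory GRing.Theory Num.Theory.

Local Open Scope classical_set_scope.
Local Open Scope ring_scope.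

Section Priestley.
Context {d : Order.disp_t}.

Definition up_set {T : porderType d} (C : set T) : Prop :=
  forall x y, C x -> (x <= y)%O -> C y.

Definition priestley (X : POrderedTopological.type d) : Prop :=
  [/\ compact [set: X],
      closed [set p : X * X | (p.1 <= p.2)%O]
    & forall x y : X, ~ (x <= y)%O ->
        exists C : set X, [/\ clopen C, up_set C, C x & ~ C y] ].

End Priestley.

Section GammaSpace.
Variable R : realType.

Inductive Gamma : Type :=
| Minus of {r : R | 0 < r <= 1}   (* r^- *)
| Circ of {q : rat | 0 <= q <= 1}. (* q° *)

HB.instance Definition _ := gen_eqMixin Gamma.
HB.instance Definition _ := gen_choiceMixin Gamma.

Definition glt (x y : Gamma) : bool :=
  match x, y with
  | Minus r, Minus s => val r < val s
  | Circ p, Circ q => val p < val q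
  | Minus r, Circ q => val r <= ratr (val q)
  | Circ q, Minus r => ratr (val q) < val r
  end.

Fact glt_irr : irreflexive glt.
Proof. by case=> r /=; rewrite ltxx. Qed.

Fact glt_trans : transitive glt.
Proof.
case=> r [] p [] q //=.
- exact: lt_trans.
- by move=> pr; apply: le_trans (ltW pr).
- exact: lt_trans.
- by move=> pr rq; rewrite -(ltr_rat R); exact: lt_le_trans rq.
- exact: le_lt_trans.
- by rewrite -(ltr_rat R) => pr /ltW; exact: le_trans.
- by rewrite -(ltr_rat R); exact: lt_trans.
- exact: lt_trans.
Qed.

Fact gamma_display : Order.disp_t. Proof. exact: Order.default_display. Qed.

HB.instance Definition _ :=
  Order.Lt_isPOrder.Build gamma_display Gamma glt_irr glt_trans.

Fact gle_total : total (<=%O : rel Gamma).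
Proof.
have leE (x y : Gamma) : (x <= y)%O = (x == y) || glt x y by [].
case=> r [] s; rewrite !leE /=.
- case: (ltgtP (val r) (val s)) => [_|_|/val_inj ->];
    by rewrite ?eqxx ?orbT.
- by rewrite -orbA; case: leP; rewrite ?orbT.
- by rewrite -orbA; case: ltP; rewrite ?orbT.
- case: (ltgtP (val r) (val s)) => [_|_|/val_inj ->];
    by rewrite ?eqxx ?orbT.
Qed.

HB.instance Definition _ :=
  Order.POrder_isTotal.Build gamma_display Gamma gle_total.

(* The subbase is indexed by itself. *)
HB.instance Definition _ := isSubBaseTopological.Build Gamma
  ([set [set x : Gamma | (Circ p <= x)%O] | p in [set: {q : rat | 0 <= q <= 1}]]
   `|` [set [set x : Gamma | (x <= Minus r)%O] | r in [set r | rational (val r)]])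
  id.

Fact unit_rat0 : 0 <= (0 : rat) <= 1. Proof. by []. Qed.
Fact unit_real1 : 0 < (1 : R) <= 1. Proof. by rewrite ltr01 lexx. Qed.

(* [circ q] is q° for 0 <= q <= 1 and [minus r] is r^- for 0 < r <= 1; the
   values elsewhere are junk. *)
Definition circ (q : rat) : Gamma := Circ (insubd (Sub 0 unit_rat0) q).
Definition minus (r : R) : Gamma := Minus (insubd (Sub 1 unit_real1) r).

(* t° if t is rational, t^- otherwise. *)
Definition gof (t : R) : Gamma :=
  if `[< rational t >] then circ (xget 0 [set q : rat | ratr q = t])
  else minus t.

(* The partial operation x - y: totalised, and only meaningful for y <= x. *)
Definition gsub (x y : Gamma) : Gamma :=
  match x, y with
  | Circ r, Circ s => circ (val r - val s)
  | Minus r, Circ s => minus (val r - ratr (val s))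
  | Circ r, Minus s => gof (ratr (val r) - val s)
  | Minus r, Minus s => gof (val r - val s)
  end.

(* The partial operation x ~ y: also only meaningful for y <= x; the set is
   empty exactly when y = x, and its supremum is then the bottom 0°. *)
Definition gsim (x y : Gamma) : Gamma :=
  supremum (circ 0)
    [set gsub x (Circ q) | q in [set q | (y < Circ q)%O /\ (Circ q <= x)%O]].

End GammaSpace.

Section Measures.
Context (R : realType) {d : Order.disp_t} (D : tbDistrLatticeType d).

(* By monotonicity, every use of [gsub] and [gsim] is at arguments y <= x. *)
Definition is_gmeasure (mu : D -> Gamma R) : Prop :=
  [/\ forall a b : D, (a <= b)%O -> (mu a <= mu b)%O,
      mu \bot%O = circ R 0 /\ mu \top%O = circ R 1
    & forall a b : D,
        (gsim (mu a) (mu (a `&` b)%O) <= gsub (mu (a `|` b)%O) (mu b))%O /\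
        (gsub (mu a) (mu (a `&` b)%O) >= gsim (mu (a `|` b)%O) (mu b))%O ].

Record gmeasure : Type := GMeasure {
  gmeasure_fun :> D -> Gamma R;
  gmeasureP : `[< is_gmeasure gmeasure_fun >] }.

HB.instance Definition _ := [isSub for gmeasure_fun].
HB.instance Definition _ := [Choice of gmeasure by <:].

(* The base order is the pointwise one on [D -> Gamma R]. *)
HB.instance Definition _ :=
  [SubChoice_isSubPOrder of gmeasure by <: with gamma_display].

HB.instance Definition _ := Topological.copy gmeasure
  (initial_topology (gmeasure_fun : gmeasure -> {ptws D -> Gamma R})).

End Measures.

(* Main.v *)
(* A point x of Gamma is determined by the set of rationals q with q° <= x.  In
   terms of these cuts the partial difference is a residual, and x ~ y <= z - v
   becomes a family of implications between finitely many statements "q belongs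
   to the cut of a value".  Each such statement defines a clopen set of measures,
   and the measure axioms, being implications of this kind, pass from almost all
   measures along an ultrafilter to the limit; this gives compactness.  Closedness
   of the order and Priestley separation follow by looking at a single cut. *)

Require Import Defs.
From mathcomp Require Import all_boot all_order all_algebra.
From mathcomp Require Import all_classical all_reals all_analysis.
From mathcomp Require Import finmap lra.

Set Implicit Arguments.
Unset Strict Implicit.
Unset Printing Implicit Defensive.

Import Order.TTheory GRing.Theory Num.Theory.

Local Open Scope classical_set_scope.
Local Open Scope ring_scope.

Lemma rat_dense (R : realType) (x y : R) : x < y -> exists q : rat, x < ratr q < y.
Proof. by move=> /rat_in_itvoo[q]; rewrite in_itv /=; exists q. Qed.

(** * Rational cuts of points of Γ, and the two partial differences in terms of cuts *)

Section Cut.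
Variable R : realType.
Implicit Types (x y z v : Gamma R) (p q : rat).

(** The relation q° <= x, extended from [0,1] to all rationals so that sums of rationals need no
    range condition: negative q always belong, q > 1 never. *)
Definition cut x q : bool :=
  match x with Minus r => ratr q < val r | Circ p => q <= val p end.

Lemma cut_down x p q : p <= q -> cut x q -> cut x p.
Proof.
case: x => [r|s] /= pq; last exact: le_trans.
by apply: le_lt_trans; rewrite ler_rat.
Qed.

Lemma cut0 x : cut x 0.
Proof. by case: x => -[r /= /andP[]] //; rewrite rmorph0. Qed.

Lemma cut_le1 x q : cut x q -> q <= 1.
Proof.
case: x => -[r /= /andP[_ r1]] qr; last exact: le_trans r1.
by rewrite -(ler_rat R) rmorph1 (le_trans (ltW qr)).
Qed.

Lemma gleE x y : (x <= y)%O =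
  match x, y with
  | Minus r, Minus s => val r <= val s
  | Circ p, Circ q => val p <= val q
  | Minus r, Circ s => val r <= ratr (val s)
  | Circ q, Minus r => ratr (val q) < val r
  end.
Proof.
rewrite [LHS](_ : _ = (x == y) || glt x y)//.
case: x y => r [] s /=.
- have [->|rs] := eqVneq r s; first by rewrite eqxx lexx.
  rewrite le_eqVlt (inj_eq val_inj) (negbTE rs) /=.
  by case: eqVneq => //= -[rs']; rewrite rs' eqxx in rs.
- by case: eqVneq.
- by case: eqVneq.
- have [->|rs] := eqVneq r s; first by rewrite eqxx lexx.
  rewrite le_eqVlt (inj_eq val_inj) (negbTE rs) /=.
  by case: eqVneq => //= -[rs']; rewrite rs' eqxx in rs.
Qed.

Lemma le_circ x (q : {q : rat | 0 <= q <= 1}) : (Circ R q <= x)%O = cut x (val q).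
Proof. by rewrite gleE; case: x. Qed.

(** If [x <= y] fails, a single rational shows it: p when x is p°, and by density one strictly
    between the two values when x is r^-. *)
Lemma le_cut x y : (x <= y)%O <-> forall q, cut x q -> cut y q.
Proof.
split; rewrite gleE; case: x y => r [] s /=.
- by move=> rs q qr; exact: lt_le_trans rs.
- by move=> rs q qr; rewrite -(ler_rat R) ltW// (lt_le_trans qr).
- by move=> rs q qr; rewrite (le_lt_trans _ rs)// ler_rat.
- by move=> rs q qr; exact: le_trans rs.
- move=> H; rewrite leNgt; apply/negP => /rat_dense[q /andP[sq qr]].
  by have := H _ qr; rewrite ltNge (ltW sq).
- move=> H; rewrite leNgt; apply/negP => /rat_dense[q /andP[sq qr]].
  by have := H _ qr; rewrite -(ler_rat R) leNgt sq.
- by apply.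
- by apply.
Qed.

(* If U has a maximum q the point is q°, otherwise it is r^- with r = sup U. *)
Lemma cut_surj (U : set rat) :
    (forall p q, p <= q -> U q -> U p) -> U 0 -> (forall q, U q -> q <= 1) ->
  exists x, forall q, cut x q <-> U q.
Proof.
move=> Ud U0 U1.
have [[q0 [Uq0 q0max]]|nomax] := pselect (exists q0, U q0 /\ ubound U q0).
  have q001 : 0 <= q0 <= 1 by rewrite U1// andbT; exact: q0max.
  exists (Circ R (exist _ q0 q001)) => q /=; split; first by move=> /Ud; apply.
  exact: q0max.
have supU : has_sup (ratr @` U : set R).
  split; first by exists (ratr 0), 0.
  by exists 1 => _ [q Uq <-]; rewrite -(rmorph1 (ratr : rat -> R)) ler_rat U1.
(* An element of [U] attaining the supremum would be a maximum. *)
have lt_supU q : U q -> ratr q < sup (ratr @` U : set R).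
  move=> Uq; apply: contrapT => /negP; rewrite -leNgt => supq; apply: nomax.
  exists q; split=> // p Up; rewrite -(ler_rat R) (le_trans _ supq)//.
  by apply: ub_le_sup; [case: supU|exists p].
have s01 : 0 < sup (ratr @` U : set R) <= 1.
  apply/andP; split; first by have := lt_supU _ U0; rewrite rmorph0.
  apply: ge_sup; first by case: supU.
  by move=> _ [q Uq <-]; rewrite -(rmorph1 (ratr : rat -> R)) ler_rat U1.
exists (Minus (exist (fun r : R => is_true (0 < r <= 1)) _ s01)) => q /=; split; last exact: lt_supU.
rewrite -subr_gt0 => /sup_adherent-/(_ _ supU)[_ [p Up <-]].
by rewrite subKr ltr_rat => /ltW /Ud; exact.
Qed.

(** The union of the cuts of the members is again a cut, and its point is the least upper bound. *)
Lemma supremums_neq0 (A : set (Gamma R)) : A !=set0 -> supremums A !=set0.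
Proof.
move=> [a Aa].
have [||q [b _ bq]|x xU] := @cut_surj (fun q => exists2 a, A a & cut a q).
- by move=> p q pq [b Ab bq]; exists b => //; exact: cut_down bq.
- by exists a => //; exact: cut0.
- exact: cut_le1 bq.
exists x; split=> [b Ab|b ub].
  by apply/le_cut => q bq; apply/xU; exists b.
by apply/le_cut => q /xU[c /ub] /le_cut; apply.
Qed.

Lemma supremum_le (A : set (Gamma R)) x0 v :
  (x0 <= v)%O -> (supremum x0 A <= v)%O <-> ubound A v.
Proof.
move=> x0v; split=> [Av a Aa|Av].
  apply: le_trans Av; apply: ge_supremum_Nmem => //.
  by apply: supremums_neq0; exists a.
rewrite /supremum; case: eqVneq => // /set0P A0.
by have /(xgetPex x0)[_] := supremums_neq0 A0; apply.
Qed.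

Lemma cut_circ p q : 0 <= q <= 1 -> cut (circ R q) p = (p <= q).
Proof. by move=> q01; rewrite /circ /= insubdK. Qed.

Lemma cut_minus p (r : R) : 0 < r <= 1 -> cut (minus r) p = (ratr p < r).
Proof. by move=> r01; rewrite /minus /= insubdK. Qed.

(** For irrational t the strict inequality defining the cut of t^- agrees with the weak one, so both
    branches of [gof] have the same description. *)
Lemma cut_gof p (t : R) : 0 <= t <= 1 -> cut (gof t) p = (ratr p <= t).
Proof.
move=> /andP[t0 t1]; rewrite /gof; case: asboolP => [[q _ qt]|irr].
  have := @xgetPex _ 0 [set q : rat | ratr q = t] (ex_intro _ q qt).
  move: (xget _ _) => {qt}q; rewrite [X in X -> _]/mkset => qt.
  rewrite cut_circ; first by rewrite -qt ler_rat.
  by rewrite -!(ler_rat R) qt rmorph0 rmorph1 t0.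
have tN q : ratr q != t by apply/eqP => qt; apply: irr; exists q.
rewrite cut_minus; first by rewrite le_eqVlt (negbTE (tN p)).
rewrite t1 andbT lt_neqAle t0 andbT -(rmorph0 (ratr : rat -> R)); exact: tN.
Qed.

(* The partial difference is the residual of addition of rational cuts. *)
Lemma cut_gsub x y p : (y <= x)%O ->
  cut (gsub x y) p <-> forall q, cut y q -> cut x (p + q).
Proof.
have L q : (ratr (p + q) : R) = ratr p + ratr q by rewrite rmorphD.
case: x y => [[r r01]|[r r01]] [[s s01]|[s s01]];
  rewrite gleE [gsub _ _]/= [X in is_true X -> _]/= => sr.
- rewrite cut_gof; last by move/andP: r01 s01 => [? ?] /andP[? ?]; lra.
  split=> /= [prs q qs|H]; first by rewrite L; lra.
  (* Otherwise a rational q strictly between r - p and s lies in the cut of s^-, while p + q exceeds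
     r. *)
  rewrite leNgt; apply/negP => prs.
  have /rat_dense[q /andP[rq qs]] : r - ratr p < s by lra.
  by have := H _ qs; rewrite L; lra.
- rewrite cut_minus; last first.
    move/andP: r01 s01 => [? ?] /andP[s0 ?].
    by move: s0; rewrite -(ler_rat R) rmorph0; lra.
  (* The cut of s° has the maximum s, so the converse only tests q = s. *)
  split=> /= [prs q|/(_ s (lexx _))]; last by rewrite L; lra.
  by rewrite -(ler_rat R) L; lra.
- rewrite cut_gof; last first.
    move/andP: r01 s01 => [? r1] /andP[s0 ?].
    by move: r1; rewrite -(ler_rat R) rmorph1; lra.
  split=> /= [prs q qs|H]; first by rewrite -(ler_rat R) L; lra.
  rewrite leNgt; apply/negP => prs.
  have /rat_dense[q /andP[rq qs]] : ratr r - ratr p < s by lra.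
  by have := H _ qs; rewrite -(ler_rat R) L; lra.
- rewrite cut_circ; last by move/andP: r01 s01 => [? ?] /andP[? ?]; lra.
  split=> /= [prs q qs|/(_ s (lexx _))]; lra.
Qed.

Lemma circ0_le x : (circ R 0 <= x)%O.
Proof. by apply/le_cut => q; rewrite cut_circ// => /cut_down; apply; exact: cut0. Qed.

(** The conditions on q alone say that q° is a point with y < q° <= x. Since q is the maximum of the
    cut of q°, the residual law puts p in the cut of x - q° exactly when p + q is in that of x. *)
Lemma gsim_le x y v : (gsim x y <= v)%O <->
  forall p q, 0 <= q -> ~~ cut y q -> cut x q -> cut x (p + q) -> cut v p.
Proof.
rewrite /gsim supremum_le ?circ0_le//; split=> [ubv p q q0 yq xq xpq|H].
  have q01 : 0 <= q <= 1 by rewrite q0 (cut_le1 xq).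
  have qx : (Circ R (exist _ q q01) <= x)%O by rewrite le_circ.
  have /le_cut : (gsub x (Circ R (exist _ q q01)) <= v)%O.
    by apply: ubv; exists (exist _ q q01) => //; split=> //; rewrite ltNge le_circ.
  apply; apply/(cut_gsub _ qx) => t /= tq; apply: cut_down xpq.
  by rewrite lerD2l.
move=> _ [q [yq qx] <-]; apply/le_cut => p /(cut_gsub _ qx) xp.
have /andP[q0 _] := valP q.
apply: (H p (val q)) => //; rewrite -?le_circ -?ltNge//.
exact: xp (lexx _).
Qed.

Lemma gsim_le_gsub x y z v : (v <= z)%O ->
  (gsim x y <= gsub z v)%O <->
  forall p q t, 0 <= q -> ~~ cut y q -> cut x q -> cut x (p + q) -> cut v t ->
    cut z (p + t).
Proof.
move=> vz; rewrite gsim_le; split=> [H p q t q0 yq xq xpq|H p q q0 yq xq xpq].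
  by move=> vt; apply: (cut_gsub p vz).1 vt; exact: (H p q).
by apply/(cut_gsub _ vz) => t; exact: (H p q t).
Qed.

Lemma circ_cut x q : 0 <= q <= 1 -> x = circ R q <-> forall p, cut x p <-> p <= q.
Proof.
move=> q01; split=> [-> p|xq]; first by rewrite cut_circ.
by apply/le_anti/andP; split; apply/le_cut => p; rewrite cut_circ// => /xq.
Qed.

End Cut.

(** * The topology of Γ in terms of cuts *)

Section Topology.
Variable R : realType.
Implicit Types x : Gamma R.

Definition gamma_subbase : set (set (Gamma R)) :=
  [set [set x | (Circ R p <= x)%O] | p in [set: {q : rat | 0 <= q <= 1}]]
  `|` [set [set x | (x <= Minus r)%O] | r in [set r | rational (val r)]].

Lemma open_subbase A : gamma_subbase A -> open A.
Proof.
move=> sA; exists [set A]; last by rewrite bigcup_set1.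
move=> _ ->; exists [fset A]%fset; last by rewrite set_fset1 bigcap_set1.
by move=> B; rewrite !inE => /eqP->; exact: mem_set.
Qed.

Lemma cvg_subbase (F : set_system (Gamma R)) x : Filter F ->
  (forall A, gamma_subbase A -> A x -> F A) -> F --> x.
Proof.
move=> FF FA A /=; rewrite nbhsE => -[_ [[B sB <-] [C BC Cx] sUBA]].
rewrite nbhs_filterE; apply: filterS sUBA _; apply: (@filterS _ _ _ C).
  by move=> ? ?; exists C.
have /sB [E sE IEC] := BC; rewrite -IEC; apply: filter_bigI => G EG.
have /set_mem sG := sE _ EG; apply: FA => //.
by move: Cx; rewrite -IEC => /(_ _ EG).
Qed.

(** For rational q, the point q^- is the immediate predecessor of q°, so the lower subbasic set at q
    is the complement of the upper one. *)
Lemma le_minus x (r : {r : R | 0 < r <= 1}) q : ratr q = val r ->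
  (x <= Minus r)%O = ~~ cut x q.
Proof.
move=> qr; rewrite gleE; case: x => s /=; first by rewrite -leNgt qr.
by rewrite -ltNge -(ltr_rat R) qr.
Qed.

(** The set is everything for [q <= 0], empty for [q > 1], and subbasic in between. *)
Lemma open_cut q : open [set x : Gamma R | cut x q].
Proof.
have [q0|q0] := leP q 0.
  rewrite (_ : [set _ | _] = setT) ?predeqE; first exact: openT.
  by move=> x; split=> // _; exact: cut_down (cut0 x).
have [q1|q1] := leP q 1; last first.
  rewrite (_ : [set _ | _] = set0) ?predeqE; first exact: open0.
  by move=> x; split=> // /cut_le1; rewrite leNgt q1.
have q01 : 0 <= q <= 1 by rewrite (ltW q0).
apply: open_subbase; left; exists (exist _ q q01) => //.
by apply/seteqP; split=> x /=; rewrite le_circ.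
Qed.

Lemma open_ncut q : open [set x : Gamma R | ~~ cut x q].
Proof.
have [q0|q0] := leP q 0.
  rewrite (_ : [set _ | _] = set0) ?predeqE; first exact: open0.
  by move=> x; split=> // /negP; apply; exact: cut_down (cut0 x).
have [q1|q1] := leP q 1; last first.
  rewrite (_ : [set _ | _] = setT) ?predeqE; first exact: openT.
  by move=> x; split=> // _; apply/negP => /cut_le1; rewrite leNgt q1.
have q01 : 0 < (ratr q : R) <= 1.
  by rewrite -(rmorph0 (ratr : rat -> R)) -(rmorph1 (ratr : rat -> R)) ltr_rat ler_rat q0.
apply: open_subbase; right; exists (exist (fun r : R => is_true (0 < r <= 1)) _ q01).
  by exists q.
by apply/seteqP; split=> x /=; rewrite (@le_minus _ _ q).
Qed.

Lemma cvg_cut (F : set_system (Gamma R)) x : Filter F ->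
    (forall q, cut x q -> F [set y | cut y q]) ->
    (forall q, ~~ cut x q -> F [set y | ~~ cut y q]) ->
  F --> x.
Proof.
move=> FF Fcut Fncut; apply: cvg_subbase => A [[p _ <-] /=|[r [q _ qr] <-] /=].
  by rewrite le_circ => /Fcut; apply: filterS => y /=; rewrite le_circ.
by rewrite (le_minus _ qr) => /Fncut; apply: filterS => y /=; rewrite (le_minus _ qr).
Qed.

End Topology.

(** * The space of measures: axioms as cut conditions, compactness, closed order *)

Section Measure.
Context (R : realType) {d : Order.disp_t} (D : tbDistrLatticeType d).
Implicit Types (a b : D) (p q t : rat) (m : gmeasure R D).

(** The measure axioms with both differences eliminated by [gsim_le_gsub]. An arbitrary predicate
    [P] covers the cuts of a measure as well as their limit along an ultrafilter. As every cut
    contains 0 and nothing above 1, one condition each fixes the values at bottom and top. *)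
Definition cut_measure (P : D -> rat -> Prop) : Prop :=
  [/\ forall a b q, (a <= b)%O -> P a q -> P b q,
      forall q, 0 < q -> ~ P \bot%O q,
      P \top%O 1
    & forall a b p q t, 0 <= q ->
      (~ P (a `&` b)%O q -> P a q -> P a (p + q) -> P b t ->
         P (a `|` b)%O (p + t)) /\
      (~ P b q -> P (a `|` b)%O q -> P (a `|` b)%O (p + q) -> P (a `&` b)%O t ->
         P a (p + t))].

Lemma is_gmeasureP (mu : D -> Gamma R) :
  is_gmeasure mu <-> cut_measure (fun a => cut (mu a)).
Proof.
split=> [[mono [mu0 mu1] mumod]|[mono mu0 mu1 mumod]].
  split=> [a b q /mono /le_cut|q q0||a b p q t q0]; first exact.
  - by rewrite mu0 cut_circ// leNgt q0.
  - by rewrite mu1 cut_circ.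
  have [m1 m2] := mumod a b; split=> /negP.
    by apply: (gsim_le_gsub _ _ (mono _ _ (leUr _ _))).1 m1 _ _ _ q0.
  by apply: (gsim_le_gsub _ _ (mono _ _ (leIl _ _))).1 m2 _ _ _ q0.
have mo a b : (a <= b)%O -> (mu a <= mu b)%O.
  by move=> ab; apply/le_cut => q; exact: mono.
split=> //; [split|move=> a b; split].
- apply/circ_cut => // p; split=> [|p0]; last exact: cut_down (cut0 _).
  by apply: contraPT; rewrite -ltNge; exact: mu0.
- apply/circ_cut => // p; split=> [/cut_le1//|p1]; exact: cut_down mu1.
- apply/gsim_le_gsub; first exact/mo/leUr.
  by move=> p q t q0 /negP; exact: (mumod a b p q t q0).1.
- apply/gsim_le_gsub; first exact/mo/leIl.
  by move=> p q t q0 /negP; exact: (mumod a b p q t q0).2.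
Qed.

Lemma le_gmeasure m1 m2 :
  (m1 <= m2)%O <-> forall a q, cut (m1 a) q -> cut (m2 a) q.
Proof.
rewrite -[(m1 <= m2)%O]/((m1 : D -> Gamma R) <= m2)%O; split.
  by move=> /lefP m12 a; exact/le_cut.
by move=> m12; apply/lefP => a; apply/le_cut; exact: m12.
Qed.

Lemma gmeasure_eval_continuous a : continuous (fun m => m a).
Proof.
move=> m; apply: (@continuous_comp _ _ _
  (@gmeasure_fun R d D : gmeasure R D -> {ptws D -> Gamma R})
  (fun f => f a)); first exact: initial_continuous.
exact: (@proj_continuous D (fun=> Gamma R) a).
Qed.

Lemma clopen_eval_cut a q : clopen [set m : gmeasure R D | cut (m a) q].
Proof.
have /continuousP evC := @gmeasure_eval_continuous a.
split; first exact: evC (open_cut R q).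
rewrite -openC (_ : ~` _ = (fun m => m a) @^-1` [set x | ~~ cut x q]).
  exact: evC (open_ncut R q).
by apply/seteqP; split=> m /= /negP.
Qed.

(** The topology is initial for the inclusion into the product, where convergence is pointwise. *)
Lemma cvg_gmeasure (F : set_system (gmeasure R D)) m : Filter F ->
  (forall a, (fun m' => m' a) @ F --> m a) -> F --> m.
Proof.
move=> FF Fm.
have Fptws : (@gmeasure_fun R d D) @ F --> ((m : D -> Gamma R) : {ptws D -> Gamma R}).
  apply/cvg_sup => a A /= [_ [[B oB <-] Bm sBA]].
  apply: filterS sBA _; apply: (Fm a); exact: open_nbhs_nbhs.
move=> A /= [_ [[B oB <-] Bm sBA]]; rewrite nbhs_filterE.
by apply: filterS sBA _; apply: Fptws; exact: open_nbhs_nbhs.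
Qed.

(* The ultrafilter limit m is read off pointwise: q lies in the cut of m a when
   it lies in the cut of m' a for F-almost all m'. *)
Lemma gmeasure_compact : compact [set: gmeasure R D].
Proof.
rewrite compact_ultra => F FU _ /=.
pose P a q := F [set m : gmeasure R D | cut (m a) q].
(* An ultrafilter contains a set or its complement, so the negated premises of the axioms also hold
   for almost all measures. *)
have PN a q : ~ P a q -> F [set m | ~~ cut (m a) q].
  move=> nP; have [//|] := in_ultra_setVsetC [set m : gmeasure R D | cut (m a) q] FU.
  by apply: filterS => m /= /negP.
have FT (A : set (gmeasure R D)) : (forall m, A m) -> F A.
  by move=> AT; apply: filterS filterT => m _; exact: AT.
have Pcut a : exists x : Gamma R, forall q, cut x q <-> P a q.
  apply: cut_surj => [p q pq||q]; first by apply: filterS => m; exact: cut_down.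
    by apply: FT => m; exact: cut0.
  by move=> /filter_ex[m /cut_le1].
have {Pcut} [mu muP] := choice Pcut.
have mum : is_gmeasure mu.
  apply/is_gmeasureP.
  rewrite (_ : (fun a => cut (mu a)) = P :> (D -> rat -> Prop)); last first.
    by apply/funext => a; apply/funext => q; apply/propext/muP.
  have mP m := (is_gmeasureP m).1 (asboolW (gmeasureP m)).
  split=> [a b q ab|q q0 /filter_ex[m]||a b p q t q0].
  - by apply: filterS => m; have [mono _ _ _] := mP m; exact: mono.
  - by have [_ bot _ _] := mP m; exact: bot.
  - by apply: FT => m; have [_ _ top _] := mP m.
  (* Almost every [m] satisfies all four premises at once, and then its own axiom yields the
     conclusion. *)
  split=> /PN F1 F2 F3 F4; near=> m; have [_ _ _ /(_ a b p q t q0)[H1 H2]] := mP m.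
    apply: H1; [apply/negP; near: m; exact: F1|near: m..].
    + exact: F2. + exact: F3. + exact: F4.
  apply: H2; [apply/negP; near: m; exact: F1|near: m..].
  + exact: F2. + exact: F3. + exact: F4.
exists (GMeasure (asboolT mum)); split=> //.
apply: cvg_gmeasure => a; apply: cvg_cut => q /= muq; first exact/muP.
by apply: PN => /muP; exact/negP.
Unshelve. all: by end_near. Qed.

Lemma gmeasure_separation m1 m2 : ~ (m1 <= m2)%O ->
  exists a q, cut (m1 a) q /\ ~ cut (m2 a) q.
Proof.
move=> m12; apply: contrapT => H; apply: m12; apply/le_gmeasure => a q m1q.
by apply: contrapT => m2q; apply: H; exists a, q.
Qed.

Lemma gmeasure_le_closed :
  closed [set p : gmeasure R D * gmeasure R D | (p.1 <= p.2)%O].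
Proof.
rewrite -openC openE => -[m1 m2] /= /gmeasure_separation[a [q [m1q m2q]]].
pose U := [set m : gmeasure R D | cut (m a) q].
have [oU cU] : clopen U := clopen_eval_cut a q.
(* For every pair in this neighbourhood, the same [a] and [q] refute the order. *)
exists (U, ~` U).
  by split; apply: open_nbhs_nbhs; split=> //; rewrite openC.
by move=> [m1' m2'] /= [m1'q m2'q] /le_gmeasure /(_ _ _ m1'q).
Qed.

End Measure.

Theorem proposition4p3 (R : realType) (d : Order.disp_t)
    (D : tbDistrLatticeType d) : priestley (gmeasure R D).
Proof.
split; [exact: gmeasure_compact|exact: gmeasure_le_closed|].
move=> m1 m2 /gmeasure_separation[a [q [m1q m2q]]].
exists [set m : gmeasure R D | cut (m a) q]; split=> //; first exact: clopen_eval_cut.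
by move=> m m' mq /le_gmeasure; apply.
Qed.
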